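(* Let $d$ be a positive integer, let $D>1$ be a squarefree integer, and let $\varepsilon_D$ be the fundamental unit of the real quadratic field $K=\mathbb{Q}(\sqrt{D})$, with ring of integers $\mathcal{O}_K$. Denote by $n$ the order of the class of $\varepsilon_D$ in the unit group $\mathcal{U}(\mathcal{O}_K/d\mathcal{O}_K)$ and define the set $$\mathcal{H}=\left\{k\in\{0,\dots,n\} : \varepsilon_D^{4k}+\varepsilon_D^{2k}+1\equiv 0 \pmod{d\,\mathcal{O}_K}\right\}.$$ Then $$\mathcal{GP}_{(1,1,1,d)}(\mathbb{Q}(\sqrt{D}))=\bigcup_{k\in\mathcal{H}}\ \bigcup_{z\in\mathbb{Z}}\left\{(\pm\beta,\,\beta\gamma,\,\pm\beta\gamma^2) : \gamma=\varepsilon_D^{nz+k},\ \beta=\frac{1}{d}\sum_{j=0}^{2}\gamma^{1-2j}\right\}.$$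
   Context: For a number field $K$ with ring of integers $\mathcal{O}_K$ and $a,b,c,d\in\mathcal{O}_K$, $\mathcal{GP}_{(a,b,c,d)}(K)$ denotes the set of non-trivial triples $(x,y,z)\in\mathcal{O}_K^3$ in geometric progression satisfying $ax^2+by^2+cz^2=dxyz$. Here $(x,y,z)$ is in geometric progression over $\mathcal{O}_K$ if there exist $\alpha,\beta\in\mathcal{O}_K$ with $x=\alpha$, $y=\alpha\beta$, $z=\alpha\beta^2$; it is non-trivial if $\alpha\neq 0$ (i.e. $(x,y,z)\neq(0,0,0)$). The notation $(\pm r,s,\pm t)$ stands for the two triples $(r,s,t)$ and $(-r,s,-t)$ (same sign in both places). The fundamental unit $\varepsilon_D$ satisfies $\mathcal{U}(\mathcal{O}_K)=\{\pm\varepsilon_D^k : k\in\mathbb{Z}\}$, where $\mathcal{U}(R)$ denotes the group of units of a ring $R$. If $d=1$, then $n=1$ by convention. *)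

(* Defs.v *)
From mathcomp Require Import all_boot all_order all_algebra all_field.
From mathcomp Require Import boolp classical_sets.

Set Implicit Arguments.
Unset Strict Implicit.
Unset Printing Implicit Defensive.

Import GRing.Theory.
Local Open Scope classical_set_scope.
Local Open Scope ring_scope.

Definition squarefree (D : nat) : Prop := forall m : nat, (m ^ 2 %| D)%N -> m = 1%N.

Definition is_Qsqrt (D : nat) (K : fieldExtType rat) : Prop :=
  exists s : K, s ^+ 2 = D%:R /\ <<1%AS; s>>%VS = fullv.

Definition ring_of_integers (K : fieldExtType rat) : set K :=
  [set x | integralOver (intr : int -> K) x].

(* The inverse is required to exist, rather than x^-1 to be integral,
   because 0^-1 = 0 in K. *)
Definition integer_units (K : fieldExtType rat) : set K :=
  [set x | ring_of_integers x /\
           exists2 y : K, ring_of_integers y & x * y = 1].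

(* No normalisation such as eps > 1 in a real embedding is imposed: the four
   generators eps, eps^-1, -eps, -eps^-1 of the unit group modulo its torsion
   {1, -1} all satisfy this predicate. *)
Definition fundamental_unit (K : fieldExtType rat) (eps : K) : Prop :=
  @integer_units K = [set x | exists k : int, x = eps ^ k \/ x = - eps ^ k].

(* Congruence modulo the ideal of the ring of integers generated by m, i.e.
   equality of classes in the quotient ring, for integral x and y. *)
Definition int_congr (K : fieldExtType rat) (m x y : K) : Prop :=
  exists2 t : K, ring_of_integers t & x - y = m * t.

(* The order of the class of u in the unit group of the quotient of the ring
   of integers by m.  If m is a unit the quotient is the zero ring, and this
   yields n = 1. *)
Definition is_order_mod (K : fieldExtType rat) (m u : K) (n : nat) : Prop :=
  [/\ (0 < n)%N, int_congr m (u ^+ n) 1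
    & forall i : nat, (0 < i)%N -> int_congr m (u ^+ i) 1 -> (n <= i)%N].

Definition geometric_progression (K : fieldExtType rat) (t : K * K * K) : Prop :=
  exists alpha beta : K,
    [/\ ring_of_integers alpha, ring_of_integers beta
      & t = (alpha, alpha * beta, alpha * beta ^+ 2)].

Definition GP (K : fieldExtType rat) (a b c d : K) : set (K * K * K) :=
  [set t : K * K * K | let: (x, y, z) := t in
    [/\ ring_of_integers x, ring_of_integers y & ring_of_integers z] /\
    [/\ geometric_progression (x, y, z), (x, y, z) <> (0, 0, 0)
      & a * x ^+ 2 + b * y ^+ 2 + c * z ^+ 2 = d * (x * y * z)]].

(* Main.v *)
Require Import Defs.
From mathcomp Require Import all_boot all_order all_algebra all_field.
From mathcomp Require Import boolp classical_sets.
From mathcomp Require Import ring lra.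

Set Implicit Arguments.
Unset Strict Implicit.
Unset Printing Implicit Defensive.

Import GRing.Theory.
Local Open Scope classical_set_scope.
Local Open Scope ring_scope.

(** Let [f(g) = g^4 + g^2 + 1].  For a triple [(a, a g, a g^2)] with [a <> 0]
    the equation reads [f(g) = d a g^3].  If [a] and [g] are integral, then [g]
    divides [1], so [g] is a unit, [g = eps^m] or [g = - eps^m]; and [a] is
    determined by [g], namely [a = f(g) / (d g^3)], which is also
    [d^-1 (g + g^-1 + g^-3)].  Conversely, for a unit [g] this [a] is integral
    exactly when [d] divides [f(g)].  As [eps^n] is congruent to [1] modulo [d],
    this divisibility depends only on [m] modulo [n], and writing
    [m = n z + k] with [0 <= k < n] gives the parametrisation by the set [H].
    Changing the sign of [g] changes the sign of [a] and leaves [a g]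
    unchanged, which accounts for the signs.

    Non-triviality of the listed triples amounts to [f(g) <> 0].  This is where
    [K] being real enters: [f(g) = (g^2 + g + 1) (g^2 - g + 1)], so a zero of
    [f] would provide a square root of [-3] in [K], whereas a negative rational
    number is not a square in [Q(sqrt D)] (lemma [negative_rat_nonsquare]). *)

(** * Arithmetic of real quadratic fields *)

Section QuadraticField.
Variable K : fieldExtType rat.
Implicit Types (m x y u : K).

Lemma natr_neq0 (d : nat) : (0 < d)%N -> d%:R != 0 :> K.
Proof.
move=> d_gt0; rewrite -(rmorph_nat (in_alg K)) fmorph_eq0.
by rewrite Num.Theory.pnatr_eq0 -lt0n.
Qed.

(** The coordinates are not claimed to be unique: this holds also when [s] is
    rational. *)
Lemma Qsqrt_coordinates (s : K) (D : nat) :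
    s ^+ 2 = D%:R -> <<1%AS; s>>%VS = fullv ->
  forall x, exists a b : rat, x = a%:A + b *: s.
Proof.
move=> s2 sK x; have /Fadjoin_polyP[p p1 ->]: x \in <<1%AS; s>>%VS.
  by rewrite sK memvf.
have /polyOver1P[q ->] := p1.
elim/poly_ind: q => [|q c [a [b IH]]].
  by exists 0, 0; rewrite rmorph0 horner0 !scale0r addr0.
exists (b * D%:R + c), a.
rewrite rmorphD rmorphM /= map_polyX map_polyC hornerMXaddC IH /=.
rewrite -!(mulr_algl _ s) -!in_algE rmorphD rmorphM rmorph_nat /=.
by rewrite -s2; ring.
Qed.

Lemma negative_rat_nonsquare (D : nat) (q : rat) :
  is_Qsqrt D K -> q < 0 -> forall x, x ^+ 2 <> q%:A.
Proof.
move=> [s [s2 sK]] q_lt0 x xq.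
have [a [b Dx]] := Qsqrt_coordinates s2 sK x.
have sq_ge0 (r : rat) : 0 <= r ^+ 2 by exact: Num.Theory.sqr_ge0.
have rat_nsq (r : rat) : x <> r%:A.
  move=> Dr; move: xq; rewrite Dr -!in_algE -rmorphXn /=.
  by move/(fmorph_inj (in_alg K)) => rq; have := sq_ge0 r; rewrite rq; lra.
have E : (a ^+ 2 + b ^+ 2 * D%:R - q)%:A + (2 * a * b) *: s = 0.
  rewrite -(mulr_algl _ s) -!in_algE !(rmorphD, rmorphN, rmorphM, rmorphXn).
  rewrite !rmorph_nat /= -xq Dx -s2 -(mulr_algl b s) scale1r; ring.
have [ab0 | ab_neq0] := eqVneq (2 * a * b) 0.
  move: E; rewrite ab0 scale0r addr0 -in_algE => /eqP.
  rewrite fmorph_eq0 => /eqP E.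
  have D_ge0 : 0 <= D%:R :> rat by exact: Num.Theory.ler0n.
  have := Num.Theory.mulr_ge0 (sq_ge0 b) D_ge0; have := sq_ge0 a; lra.
(* The coefficient of [s] is nonzero, so [s], and with it [x], is rational. *)
have Ds : s = (- (2 * a * b)^-1 * (a ^+ 2 + b ^+ 2 * D%:R - q))%:A.
  rewrite -scalerA -[X in _ *: X](addrK ((2 * a * b) *: s)) E add0r.
  by rewrite scaleNr scalerN opprK scalerA mulVf // scale1r.
apply: (rat_nsq (a + b * (- (2 * a * b)^-1 * (a ^+ 2 + b ^+ 2 * D%:R - q)))).
by rewrite Dx {1}Ds scalerA -scalerDl.
Qed.

Lemma trinomial_neq0 (D : nat) x : is_Qsqrt D K -> x ^+ 4 + x ^+ 2 + 1 != 0.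
Proof.
move=> hK; apply/eqP => x0.
have no3 (y : K) : y ^+ 2 <> - 3%:R.
  have := @negative_rat_nonsquare D (- 3%:R) hK isT y.
  by rewrite scaleNr scaler_nat.
have : (x ^+ 2 + x + 1) * (x ^+ 2 - x + 1) = 0 by rewrite -x0; ring.
move/eqP; rewrite mulf_eq0 => /orP[] /eqP x1.
  apply: (no3 (2 * x + 1)); rewrite -[RHS]addr0 -[in RHS](mulr0 4) -x1; ring.
apply: (no3 (2 * x - 1)); rewrite -[RHS]addr0 -[in RHS](mulr0 4) -x1; ring.
Qed.

Lemma trinomialN x : (- x) ^+ 4 + (- x) ^+ 2 + 1 = x ^+ 4 + x ^+ 2 + 1.
Proof. by ring. Qed.

(** * Integers and units *)

Lemma ring_of_integers0 : ring_of_integers (0 : K).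
Proof. exact: integral0. Qed.

Lemma ring_of_integers1 : ring_of_integers (1 : K).
Proof. exact: integral1. Qed.

Lemma ring_of_integersN x : ring_of_integers x -> ring_of_integers (- x).
Proof. exact: integral_opp. Qed.

Lemma ring_of_integersD x y :
  ring_of_integers x -> ring_of_integers y -> ring_of_integers (x + y).
Proof. exact: integral_add. Qed.

Lemma ring_of_integersM x y :
  ring_of_integers x -> ring_of_integers y -> ring_of_integers (x * y).
Proof. exact: integral_mul. Qed.

Lemma ring_of_integersX x k : ring_of_integers x -> ring_of_integers (x ^+ k).
Proof.
move=> xI; elim: k => [|k IHk]; first exact: ring_of_integers1.
by rewrite exprS; apply: ring_of_integersM.
Qed.

Lemma integer_unitsP u :
  integer_units u <->
  [/\ ring_of_integers u, ring_of_integers u^-1 & u != 0].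
Proof.
split=> [[uI [v vI uv]]|[uI u'I u_neq0]]; last first.
  by split=> //; exists u^-1; rewrite ?divff.
have u_neq0 : u != 0.
  by apply: contra_eq_neq uv => ->; rewrite mul0r eq_sym oner_eq0.
by split=> //; rewrite -[u^-1]mulr1 -uv mulKf.
Qed.

(** * Congruences between integers *)

Lemma int_congr_refl m x : int_congr m x x.
Proof. by exists 0; [exact: ring_of_integers0 | rewrite mulr0 subrr]. Qed.

Lemma int_congr_sym m x y : int_congr m x y -> int_congr m y x.
Proof.
case=> t tI Dt; exists (- t); first exact: ring_of_integersN.
by rewrite mulrN -Dt opprB.
Qed.

Lemma int_congr_trans m x y z :
  int_congr m x y -> int_congr m y z -> int_congr m x z.
Proof.
case=> t tI Dt [w wI Dw]; exists (t + w); first exact: ring_of_integersD.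
by rewrite mulrDr -Dt -Dw addrA subrK.
Qed.

Lemma int_congrMl m z x y :
  ring_of_integers z -> int_congr m x y -> int_congr m (z * x) (z * y).
Proof.
move=> zI [t tI Dt]; exists (z * t); first exact: ring_of_integersM.
by rewrite mulrCA -Dt mulrBr.
Qed.

Lemma int_congr1X m u k :
  ring_of_integers u -> int_congr m u 1 -> int_congr m (u ^+ k) 1.
Proof.
move=> uI u1; elim: k => [|k IHk]; first exact: int_congr_refl.
apply: int_congr_trans u1; rewrite exprS -[X in int_congr _ _ X]mulr1.
exact: int_congrMl.
Qed.

Lemma int_congr1Xz m u (z : int) :
  integer_units u -> int_congr m u 1 -> int_congr m (u ^ z) 1.
Proof.
move=> /integer_unitsP[uI u'I u_neq0] u1; case: z => k.
  exact: int_congr1X.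
rewrite NegzE -exprnN -exprVn; apply: int_congr1X => //.
by have /int_congr_sym := int_congrMl u'I u1; rewrite mulVf // mulr1.
Qed.

Lemma int_congr_trinomial m x y :
    ring_of_integers x -> ring_of_integers y -> int_congr m x y ->
  int_congr m (x ^+ 4 + x ^+ 2 + 1) (y ^+ 4 + y ^+ 2 + 1).
Proof.
move=> xI yI [t tI Dt]; exists (t * ((x + y) * (x ^+ 2 + y ^+ 2 + 1))).
  apply: ring_of_integersM => //; apply: ring_of_integersM.
    exact: ring_of_integersD.
  apply: ring_of_integersD ring_of_integers1.
  by apply: ring_of_integersD; apply: ring_of_integersX.
by rewrite mulrA -Dt; ring.
Qed.

(** * Solutions and units *)

(** The first term [d^-1 (g + g^-1 + g^-3)] of the progression of ratio [g]. *)
Definition first_term (d : nat) (g : K) : K :=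
  d%:R^-1 * \sum_(j < 3) g ^ (1 - 2 * (nat_of_ord j)%:Z).

Lemma first_termE d g :
  g != 0 -> first_term d g = (g ^+ 4 + g ^+ 2 + 1) / (d%:R * g ^+ 3).
Proof.
move=> g_neq0; rewrite /first_term !big_ord_recl big_ord0 addr0 /=.
have -> : g ^ (1 - 2 * 0%:Z) = g by [].
have -> : g ^ (1 - 2 * (bump 0 0)%:Z) = g^-1 by [].
have -> : g ^ (1 - 2 * (bump 0 (bump 0 0))%:Z) = (g ^+ 3)^-1 by [].
rewrite [in RHS]invfM [RHS]mulrCA; congr (_ * _); field.
by [].
Qed.

Lemma first_termN d g : g != 0 -> first_term d (- g) = - first_term d g.
Proof.
move=> g_neq0; rewrite !first_termE ?oppr_eq0 // trinomialN.
by rewrite [(- g) ^+ 3]exprNn -signr_odd /= expr1 mulN1r mulrN invrN mulrN.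
Qed.

Lemma first_term_integer d g : (0 < d)%N -> integer_units g ->
  ring_of_integers (first_term d g) <->
  int_congr d%:R (g ^+ 4 + g ^+ 2 + 1) 0.
Proof.
move=> /natr_neq0 d_neq0 /integer_unitsP[gI g'I g_neq0].
rewrite first_termE //; split=> [bI | [t tI]].
  exists ((g ^+ 4 + g ^+ 2 + 1) / (d%:R * g ^+ 3) * g ^+ 3).
    exact: ring_of_integersM (ring_of_integersX _ gI).
  by field; rewrite g_neq0 d_neq0.
rewrite subr0 => ->; rewrite (_ : _ / _ = t * g^-1 ^+ 3).
  exact: ring_of_integersM (ring_of_integersX _ g'I).
by field; rewrite g_neq0 d_neq0.
Qed.

(** The solutions are parametrised by the units [g] for which [d] divides
    [g^4 + g^2 + 1], whatever the structure of the unit group. *)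
Lemma GP_unitsP (D d : nat) (t : K * K * K) : is_Qsqrt D K -> (0 < d)%N ->
  @GP K 1 1 1 d%:R t <->
  exists g, [/\ integer_units g, int_congr d%:R (g ^+ 4 + g ^+ 2 + 1) 0 &
    t = (first_term d g, first_term d g * g, first_term d g * g ^+ 2)].
Proof.
move=> hK d_gt0; have d_neq0 := natr_neq0 d_gt0; split; last first.
  move=> [g [gU fg0 ->]]; have bI := (first_term_integer d_gt0 gU).2 fg0.
  have [gI _ g_neq0] := (integer_unitsP g).1 gU.
  split; first split=> //.
  - exact: ring_of_integersM.
  - exact: ring_of_integersM (ring_of_integersX _ gI).
  split; first by exists (first_term d g), g.
    case=> /eqP b0 _ _; move: b0; apply/negP.
    rewrite first_termE // mulf_neq0 ?(trinomial_neq0 _ hK) // invr_neq0 //.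
    by rewrite mulf_neq0 ?expf_neq0.
  by rewrite first_termE //; field; rewrite g_neq0 d_neq0.
case: t => [[x y] z] [_ [[a [g [aI gI [-> -> ->]]]] nt eq_dag]].
have a_neq0 : a != 0 by apply: contra_notN nt => /eqP->; rewrite !mul0r.
have fg : g ^+ 4 + g ^+ 2 + 1 = d%:R * a * g ^+ 3.
  apply: (mulfI (expf_neq0 2 a_neq0)).
  transitivity (d%:R * (a * (a * g) * (a * g ^+ 2))); last by ring.
  by rewrite -eq_dag; ring.
(* Dividing the equation by [a^2] exhibits the inverse of [g]. *)
have gV : g * (d%:R * a * g ^+ 2 - g - g ^+ 3) = 1.
  transitivity (d%:R * a * g ^+ 3 - g ^+ 2 - g ^+ 4); first by ring.
  by rewrite -fg; ring.
have gU : integer_units g.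
  split=> //; exists (d%:R * a * g ^+ 2 - g - g ^+ 3) => //.
  have dI : ring_of_integers (d%:R : K) by exact: integral_nat.
  apply: ring_of_integersD; last exact/ring_of_integersN/ring_of_integersX.
  apply: ring_of_integersD; last exact/ring_of_integersN.
  apply: ring_of_integersM; first exact: ring_of_integersM.
  exact: ring_of_integersX.
have [_ _ g_neq0] := (integer_unitsP g).1 gU.
have Da : first_term d g = a.
  by rewrite first_termE // fg; field; rewrite g_neq0 d_neq0.
by exists g; split=> //; [apply/first_term_integer; rewrite ?Da | rewrite Da].
Qed.

End QuadraticField.

Theorem theorem4p8 (d : nat) (hd : (0 < d)%N)
    (D : nat) (hD1 : (1 < D)%N) (hD : squarefree D)
    (K : fieldExtType rat) (hK : is_Qsqrt D K)
    (eps : K) (heps : fundamental_unit eps)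
    (n : nat) (hn : is_order_mod d%:R eps n) :
  let H : set nat :=
    [set k : nat | (k <= n)%N /\
       int_congr d%:R (eps ^+ (4 * k) + eps ^+ (2 * k) + 1) 0] in
  @GP K 1 1 1 d%:R =
    \bigcup_(k in H) \bigcup_(z in [set: int])
      (let gamma : K := eps ^ (n%:Z * z + k%:Z) in
       let beta : K := d%:R^-1 * \sum_(j < 3) gamma ^ (1 - 2 * (nat_of_ord j)%:Z) in
       [set (beta, beta * gamma, beta * gamma ^+ 2);
            (- beta, beta * gamma, - (beta * gamma ^+ 2))]).
Proof.
move=> H; case: hn => n_gt0 epsn1 _.
have powU (m : int) : integer_units (eps ^ m) by rewrite heps; exists m; left.
have powNU (m : int) : integer_units (- eps ^ m).
  by rewrite heps; exists m; right.
have eps_neq0 : eps != 0 by have /integer_unitsP[] := powU 1.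
have powI (m : int) : ring_of_integers (eps ^ m).
  by have /integer_unitsP[] := powU m.
have pow_congr (z : int) (k : nat) :
    int_congr d%:R (eps ^ (n%:Z * z + k%:Z)) (eps ^+ k).
  rewrite expfzDr // -exprz_exp mulrC -[X in int_congr _ _ X]mulr1.
  by apply: int_congrMl; [exact: powI k | exact: int_congr1Xz (powU n) epsn1].
have trinomial_congr (z : int) (k : nat) :
    int_congr d%:R ((eps ^ (n%:Z * z + k%:Z)) ^+ 4
                    + (eps ^ (n%:Z * z + k%:Z)) ^+ 2 + 1)
                   (eps ^+ (4 * k) + eps ^+ (2 * k) + 1).
  rewrite ![(_ * k)%N]mulnC !exprM.
  exact: int_congr_trinomial (powI _) (powI k) (pow_congr z k).
apply/seteqP; split=> t; last first.
  case=> k [_ fk0] [z _]; cbv zeta; set g := eps ^ _.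
  rewrite -/(first_term d g) => tE.
  have fg0 : int_congr d%:R (g ^+ 4 + g ^+ 2 + 1) 0.
    exact: int_congr_trans (trinomial_congr z k) fk0.
  apply/(GP_unitsP _ hK hd); case: tE => ->.
    by exists g; split=> //; apply: powU.
  exists (- g); split; first exact: powNU.
    by rewrite trinomialN.
  by rewrite first_termN ?expfz_neq0 // mulrNN mulNr sqrrN.
case/(GP_unitsP _ hK hd)=> g [+ fg0 ->]; rewrite heps => -[m gE].
have nz_neq0 : n%:Z != 0 by rewrite eqz_nat -lt0n.
pose k := `|(m %% n)%Z|%N; pose z := (m %/ n)%Z.
have kE : k%:Z = (m %% n)%Z by rewrite gez0_abs ?modz_ge0.
have mE : m = n%:Z * z + k%:Z by rewrite kE mulrC -divz_eq.
have k_lt_n : (k < n)%N by rewrite -ltz_nat kE ltz_pmod ?ltz_nat.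
exists k.
  split; first exact: ltnW.
  apply: int_congr_trans (int_congr_sym (trinomial_congr z k)) _; rewrite -mE.
  case: gE fg0 => -> //.
  by rewrite trinomialN.
exists z => //; cbv zeta; rewrite -mE -/(first_term d (eps ^ m)).
case: gE => ->; [left | right] => //.
by rewrite first_termN ?expfz_neq0 // sqrrN mulrNN mulNr.
Qed.
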